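(* Let $X$ and $Y\subseteq X$ be non-empty sets, let $(X,\bullet_{z_{ij}})$ be a $p$-rack magma, let $R^{z_{ij}}:X\times X\to X\times X$, $R^{z_{ij}}(b,a)=(b,\tau_b^{z_{ij}}(a))$, be a $p$-rack operator, and let $K^{z_i}:X\to X$, $a\mapsto\kappa^{z_i}(a)$, be a $p$-rack reflection operator, for all $z_i,z_j\in Y$. Then: (1) $R^{z_{ij}}$ satisfies the parametric Yang-Baxter equation. (2) $K^{z_i}$ satisfies the reflection equation. (3) For all $a,b,c\in X$ and $z_i,z_j,z_k\in Y$, $$\xi_{12}^{z_{ijk}}K_1^{z_i}\zeta_{21}^{z_{jk\bar i}}(\mathrm{id}_X\times\hat m_{z_{kj}})(c,b,a)=(\mathrm{id}_X\times\hat m_{z_{kj}})R_{13}^{z_{ik}}R_{12}^{z_{ij}}K_1^{z_i}R_{21}^{z_{j\bar i}}R_{31}^{z_{k\bar i}}(c,b,a).$$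
   Context: $z_{ij}$ (resp. $z_{ijk}$) denotes dependence on the ordered pair $(z_i,z_j)$ (resp. triple $(z_i,z_j,z_k)$) of elements of $Y$. $\mu:Y\to Y$ is a fixed involution and $z_{\bar i}:=\mu(z_i)$. Definition. Let $\bullet_{z_{ij}}$ be binary operations on $X$; put $m_{z_{ij}}(a,b)=a\bullet_{z_{ij}}b$, $\pi(a,b)=(b,a)$, $\hat m_{z_{ij}}=m_{z_{ij}}\pi$ (so $\hat m_{z_{ij}}(b,a)=a\bullet_{z_{ij}}b$). Consider maps on $X\times X$ $$R^{z_{ij}}(b,a)=(b,\tau_b^{z_{ij}}(a)),\quad\xi^{z_{ijk}}(b,a)=(b,g_b^{z_{ijk}}(a)),\quad\zeta^{z_{ijk}}(b,a)=(b,\hat g_b^{z_{ijk}}(a)),$$ where $\tau_b^{z_{ij}},g_b^{z_{ijk}},\hat g_b^{z_{ijk}}:X\to X$ are bijections, $g_b^{z_{ijk}}=g_b^{z_{ikj}}$ and $\hat g_b^{z_{ijk}}=\hat g_b^{z_{jik}}$, and bijections $K^{z_i}:X\to X$, $a\mapsto\kappa^{z_i}(a)$. Then $(X,\bullet_{z_{ij}})$ is called a $p$-rack magma, $R^{z_{ij}}$ a $p$-rack operator and $K^z$ a $p$-rack reflection operator if for all $a,b,c\in X$, $z_i,z_j,z_k\in Y$: (1) $\hat m_{z_{ji}}(b,a)=m_{z_{ij}}(R^{z_{ij}}(b,a))$; (2) $\xi^{z_{ikj}}(\mathrm{id}_X\times\hat m_{z_{kj}})(c,b,a)=(\mathrm{id}_X\times\hat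 m_{z_{kj}})R_{13}^{z_{ik}}R_{12}^{z_{ij}}(c,b,a)$; (3) $\zeta^{z_{ijk}}(\hat m_{z_{ji}}\times\mathrm{id}_X)(c,b,a)=(\hat m_{z_{ji}}\times\mathrm{id}_X)R_{13}^{z_{ik}}R_{23}^{z_{jk}}(c,b,a)$; (4) $(\mathrm{id}_X\times K^{z_j})R^{z_{i\bar j}}(a,b)=R^{z_{ij}}(\mathrm{id}_X\times K^{z_j})(a,b)$; (5) $(K^{z_i}\times\mathrm{id}_X)R^{z_{\bar ij}}(a,b)=R^{z_{ij}}(K^{z_i}\times\mathrm{id}_X)(a,b)$. Leg notation: for a map $F$ on $X\times X$, $F_{mn}$ acts as $F$ with its first argument (and output) in the $m$-th component and its second in the $n$-th component, and as the identity elsewhere; e.g. on $X^3$, $R_{12}(c,b,a)=(c,\tau_c(b),a)$, $R_{13}(c,b,a)=(c,b,\tau_c(a))$, $R_{21}(c,b,a)=(\tau_b(c),b,a)$, $R_{31}(c,b,a)=(\tau_a(c),b,a)$; on $X^2$, $\xi_{12}=\xi$ and $\zeta_{21}^{z_{ijk}}(x,y)=(\hat g_y^{z_{ijk}}(x),y)$. $K_n^z$ applies $\kappa^z$ to the $n$-th component. Parametric Yang-Baxter equation: $R_{12}^{z_{12}}R_{13}^{z_{13}}R_{23}^{z_{23}}=R_{23}^{z_{23}}R_{13}^{z_{13}}R_{12}^{z_{12}}$ on $X^3$ for all $z_1,z_2,z_3\in Y$. Reflection equation: $R_{12}^{z_{12}}K_1^{z_1}R_{21}^{z_{2\bar1}}K_2^{z_2}=K_2^{z_2}R_{12}^{z_{1\bar2}}K_1^{z_1}R_{21}^{z_{\bar2\bar1}}$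 on $X^2$ for all $z_1,z_2\in Y$. *)

(* Defs.v *)
From mathcomp Require Import all_boot classical_sets.

Set Implicit Arguments.
Unset Strict Implicit.
Unset Printing Implicit Defensive.

(* Parametric families are indexed by the elements of Y : set X, seen as a
   type: [F zi zj] is F^{z_{ij}} and [F zi zj zk] is F^{z_{ijk}}. Triples
   (c, b, a) are left-nested pairs ((c, b), a). *)

Definition flip (X : Type) (p : X * X) : X * X := (p.2, p.1).

(* (b, a) |-> (b, f_b(a)), the common shape of R, xi and zeta *)
Definition left_op (X : Type) (f : X -> X -> X) (p : X * X) : X * X :=
  (p.1, f p.1 p.2).

Definition leg1 (X : Type) (k : X -> X) (p : X * X) : X * X := (k p.1, p.2).
Definition leg2 (X : Type) (k : X -> X) (p : X * X) : X * X := (p.1, k p.2).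

Definition leg12 (X : Type) (F : X * X -> X * X) : X * X -> X * X := F.
Definition leg21 (X : Type) (F : X * X -> X * X) : X * X -> X * X :=
  @flip X \o F \o @flip X.

Definition leg1_3 (X : Type) (k : X -> X) (t : X * X * X) : X * X * X :=
  let: (x1, x2, x3) := t in (k x1, x2, x3).

Definition leg12_3 (X : Type) (F : X * X -> X * X) (t : X * X * X) :
    X * X * X :=
  let: (x1, x2, x3) := t in let: (y1, y2) := F (x1, x2) in (y1, y2, x3).
Definition leg13_3 (X : Type) (F : X * X -> X * X) (t : X * X * X) :
    X * X * X :=
  let: (x1, x2, x3) := t in let: (y1, y3) := F (x1, x3) in (y1, x2, y3).
Definition leg23_3 (X : Type) (F : X * X -> X * X) (t : X * X * X) :
    X * X * X :=
  let: (x1, x2, x3) := t in let: (y2, y3) := F (x2, x3) in (x1, y2, y3).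
Definition leg21_3 (X : Type) (F : X * X -> X * X) (t : X * X * X) :
    X * X * X :=
  let: (x1, x2, x3) := t in let: (y2, y1) := F (x2, x1) in (y1, y2, x3).
Definition leg31_3 (X : Type) (F : X * X -> X * X) (t : X * X * X) :
    X * X * X :=
  let: (x1, x2, x3) := t in let: (y3, y1) := F (x3, x1) in (y1, x2, y3).

(* id_X x f and f x id_X on X^3, for f : X^2 -> X *)
Definition id_times (X : Type) (f : X * X -> X) (t : X * X * X) : X * X :=
  let: (x1, x2, x3) := t in (x1, f (x2, x3)).
Definition times_id (X : Type) (f : X * X -> X) (t : X * X * X) : X * X :=
  let: (x1, x2, x3) := t in (f (x1, x2), x3).

Section ParametricFamilies.
Context {X : Type} {Y : set X}.

Definition magma_map (op : Y -> Y -> X -> X -> X) (zi zj : Y) (p : X * X) : X :=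
  op zi zj p.1 p.2.

Definition magma_map_hat (op : Y -> Y -> X -> X -> X) (zi zj : Y) :
    X * X -> X :=
  magma_map op zi zj \o @flip X.

Definition rack_op (tau : Y -> Y -> X -> X -> X) (zi zj : Y) :
    X * X -> X * X :=
  left_op (tau zi zj).

Definition fusion_op (g : Y -> Y -> Y -> X -> X -> X) (zi zj zk : Y) :
    X * X -> X * X :=
  left_op (g zi zj zk).

(* The operations op form a p-rack magma, the maps R built from tau a p-rack
   operator and the maps kappa a p-rack reflection operator; the three notions
   are defined simultaneously, relative to the auxiliary g and ghat. *)
Record is_prack (mu : Y -> Y) (op tau : Y -> Y -> X -> X -> X)
    (g ghat : Y -> Y -> Y -> X -> X -> X) (kappa : Y -> X -> X) : Prop := {
  prack_tau_bij : forall zi zj b, bijective (tau zi zj b);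
  prack_g_bij : forall zi zj zk b, bijective (g zi zj zk b);
  prack_ghat_bij : forall zi zj zk b, bijective (ghat zi zj zk b);
  prack_g_sym : forall zi zj zk b, g zi zj zk b =1 g zi zk zj b;
  prack_ghat_sym : forall zi zj zk b, ghat zi zj zk b =1 ghat zj zi zk b;
  prack_kappa_bij : forall zi, bijective (kappa zi);
  prack_comm : forall zi zj,
    magma_map_hat op zj zi =1 magma_map op zi zj \o rack_op tau zi zj;
  prack_xi : forall zi zj zk,
    fusion_op g zi zk zj \o id_times (magma_map_hat op zk zj)
    =1 id_times (magma_map_hat op zk zj)
       \o leg13_3 (rack_op tau zi zk) \o leg12_3 (rack_op tau zi zj);
  prack_zeta : forall zi zj zk,
    fusion_op ghat zi zj zk \o times_id (magma_map_hat op zj zi)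
    =1 times_id (magma_map_hat op zj zi)
       \o leg13_3 (rack_op tau zi zk) \o leg23_3 (rack_op tau zj zk);
  prack_kappa_r : forall zi zj,
    leg2 (kappa zj) \o rack_op tau zi (mu zj)
    =1 rack_op tau zi zj \o leg2 (kappa zj);
  prack_kappa_l : forall zi zj,
    leg1 (kappa zi) \o rack_op tau (mu zi) zj
    =1 rack_op tau zi zj \o leg1 (kappa zi)
}.

Definition parametric_YBE (R : Y -> Y -> X * X -> X * X) : Prop :=
  forall z1 z2 z3 : Y,
    leg12_3 (R z1 z2) \o leg13_3 (R z1 z3) \o leg23_3 (R z2 z3)
    =1 leg23_3 (R z2 z3) \o leg13_3 (R z1 z3) \o leg12_3 (R z1 z2).

Definition reflection_equation (mu : Y -> Y) (R : Y -> Y -> X * X -> X * X)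
    (kappa : Y -> X -> X) : Prop :=
  forall z1 z2 : Y,
    leg12 (R z1 z2) \o leg1 (kappa z1)
      \o leg21 (R z2 (mu z1)) \o leg2 (kappa z2)
    =1 leg2 (kappa z2) \o leg12 (R z1 (mu z2))
      \o leg1 (kappa z1) \o leg21 (R (mu z2) (mu z1)).

End ParametricFamilies.

(* Main.v *)
(** Evaluated on ghat, axiom (3) says that the product tau_c tau_b depends only
    on the magma product of b and c; rewriting that product with axiom (1) and
    using the symmetry of ghat gives the self-distributivity of tau, which is the
    Yang-Baxter equation.  The reflection equation uses only the two
    commutation rules (4) and (5) of kappa with R. *)
Require Import Defs.
From mathcomp Require Import all_boot classical_sets.

Local Open Scope classical_set_scope.

Section PRackTheory.
Context {X : Type} {Y : set X} {mu : Y -> Y} {op tau : Y -> Y -> X -> X -> X}.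
Context {g ghat : Y -> Y -> Y -> X -> X -> X} {kappa : Y -> X -> X}.
Hypothesis prack : is_prack mu op tau g ghat kappa.

Lemma op_swap (zi zj : Y) (b a : X) :
  op zj zi a b = op zi zj b (tau zi zj b a).
Proof. exact: (prack_comm prack zi zj (b, a)). Qed.

(** Axiom (2) with the last two indices of [g] exchanged by symmetry, the order in which they occur
    in the fused reflection identity. *)
Lemma g_op (zi zj zk : Y) (c b a : X) :
  g zi zj zk c (op zk zj a b) = op zk zj (tau zi zk c a) (tau zi zj c b).
Proof.
by rewrite (prack_g_sym prack); case: (prack_xi prack zi zj zk (c, b, a)).
Qed.

Lemma ghat_op (zi zj zk : Y) (c b a : X) :
  ghat zi zj zk (op zj zi b c) a = tau zi zk c (tau zj zk b a).
Proof. by case: (prack_zeta prack zi zj zk (c, b, a)). Qed.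

Lemma tau_self_distributive (zi zj zk : Y) (c b a : X) :
  tau zi zk c (tau zj zk b a)
  = tau zj zk (tau zi zj c b) (tau zi zk c a).
(* Both sides become values of [ghat] at [a], for the products [op zj zi b c] and
   [op zi zj c (tau zi zj c b)], equal by axiom (1). *)
Proof. by rewrite -!ghat_op (prack_ghat_sym prack) (op_swap zi zj). Qed.

Lemma kappa_tau (zi zj : Y) (b a : X) :
  kappa zj (tau zi (mu zj) b a) = tau zi zj b (kappa zj a).
Proof. by case: (prack_kappa_r prack zi zj (b, a)). Qed.

Lemma tau_kappa (zi zj : Y) (b a : X) :
  tau zi zj (kappa zi b) a = tau (mu zi) zj b a.
Proof. by case: (prack_kappa_l prack zi zj (b, a)). Qed.

End PRackTheory.

Theorem proposition5p2 (X : Type) (Y : set X)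
  (X_neq0 : [set: X] !=set0) (Y_neq0 : Y !=set0)
  (mu : Y -> Y) (mu_invol : involutive mu)
  (op tau : Y -> Y -> X -> X -> X)
  (g ghat : Y -> Y -> Y -> X -> X -> X)
  (kappa : Y -> X -> X)
  (prack : is_prack mu op tau g ghat kappa) :
  [/\ parametric_YBE (rack_op tau),
      reflection_equation mu (rack_op tau) kappa
    & forall (a b c : X) (zi zj zk : Y),
        (leg12 (fusion_op g zi zj zk) \o leg1 (kappa zi)
           \o leg21 (fusion_op ghat zj zk (mu zi))
           \o id_times (magma_map_hat op zk zj)) (c, b, a)
        = (id_times (magma_map_hat op zk zj)
           \o leg13_3 (rack_op tau zi zk) \o leg12_3 (rack_op tau zi zj)
           \o leg1_3 (kappa zi)
           \o leg21_3 (rack_op tau zj (mu zi))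
           \o leg31_3 (rack_op tau zk (mu zi))) (c, b, a)].
Proof.
split.
- by move=> z1 z2 z3 [[c b] a] /=; rewrite (tau_self_distributive prack).
- move=> z1 z2 [x y].
  rewrite /leg12 /leg21 /leg1 /leg2 /rack_op /left_op /flip /=.
  (* The outer [kappa z2] moves inside [tau]; the one on the acting element turns [z2] into
     [mu z2]. *)
  by rewrite (kappa_tau prack z1 z2) (tau_kappa prack z2).
- move=> a b c zi zj zk.
  (* [ghat] at the product of [a] and [b] splits into their successive actions on [c]; the reflected
     result then acts through [g] on each factor of the product. *)
  rewrite /leg12 /leg21 /leg1 /fusion_op /left_op /flip /magma_map_hat.
  by rewrite /magma_map /flip /= (ghat_op prack) (g_op prack).
Qed.
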